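(* Let $\Lambda>1$ and let $\mathcal{S}\subset\mathcal{D}$ be a sparse collection of dyadic cubes in $\mathbb{R}^n$ with Carleson constant $\Lambda$ and with no infinitely increasing chains. Then the function $b_{\mathcal{S}}:=\sum_{Q\in\mathcal{S}}\mathbf{1}_Q$ belongs to $BMO^{\mathcal{D}}(\mathbb{R}^n)$, with $$\|b_{\mathcal{S}}\|_{BMO^{\mathcal{D}}(\mathbb{R}^n)}\le\Lambda .$$
   Context: $\mathcal{D}$ is a fixed dyadic grid on $\mathbb{R}^n$: a collection of cubes with side lengths $2^k$, $k\in\mathbb{Z}$, such that for each fixed $k$ the cubes of side length $2^k$ partition $\mathbb{R}^n$, and $P\cap Q\in\{P,Q,\emptyset\}$ for all $P,Q\in\mathcal{D}$. A collection $\mathcal{S}\subset\mathcal{D}$ has Carleson constant $\Lambda>1$ (is $\Lambda$-Carleson) if $\sum_{P\in\mathcal{S},P\subset Q}|P|\le\Lambda|Q|$ for all $Q\in\mathcal{D}$; it is sparse if it is $\Lambda$-Carleson for some $\Lambda>1$ (equivalently, for some $\eta\in(0,1)$ there are pairwise disjoint measurable sets $E_Q\subset Q$, $Q\in\mathcal{S}$, with $|E_Q|\ge\eta|Q|$; one may take $\eta=1/\Lambda$). $\mathcal{S}$ has an infinitely increasing chain if there are $Q_k\in\mathcal{S}$, $k\in\mathbb{N}$, with $Q_k\subsetneq Q_{k+1}$ for all $k$. $\langle f\rangle_Q=\frac1{|Q|}\int_Q f\,dx$, and $\|b\|_{BMO^{\mathcal{D}}(\mathbb{R}^n)}=\sup_{Q\in\mathcal{D}}\frac1{|Q|}\int_Q|b-\langle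 b\rangle_Q|\,dx$ for locally integrable $b$. *)

(* Defs.v *)
From HB Require Import structures.
From mathcomp Require Import all_boot all_order all_algebra.
From mathcomp Require Import all_classical all_reals all_analysis measurable_realfun.
Set Implicit Arguments.
Unset Strict Implicit.
Unset Printing Implicit Defensive.
Import Order.TTheory GRing.Theory Num.Theory.
Import numFieldNormedType.Exports.
Local Open Scope classical_set_scope.
Local Open Scope ring_scope.

(* R^n as n-tuples of reals, with the product of the Borel sigma-algebras *)
Notation Rn R n := (n.-tuple (measurableTypeR R)).

Section LebesgueRn.
Context {R : realType}.

Definition consRn n (p : measurableTypeR R * Rn R n) : Rn R n.+1 :=
  [the n.+1.-tuple _ of p.1 :: p.2].

Lemma measurable_consRn n : measurable_fun [set: _] (@consRn n).
Proof. exact: (measurable_cons measurable_fst measurable_snd). Qed.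

Section lebesgueS.
Variables (n : nat) (m : {sigma_finite_measure set (Rn R n) -> \bar R}).

Definition lebesgueS : set (Rn R n.+1) -> \bar R :=
  pushforward (lebesgue_measure \x m)%E (@consRn n).

Let pf := measure_function_pushforward__canonical__measure_function_Measure
  (lebesgue_measure \x m)%E (@measurable_consRn n).

Let lebesgueS0 : lebesgueS set0 = 0%E.
Proof. exact: (measure0 pf). Qed.

Let lebesgueS_ge0 A : (0 <= lebesgueS A)%E.
Proof. exact: (measure_ge0 pf). Qed.

Let lebesgueS_sigma_additive : semi_sigma_additive lebesgueS.
Proof. exact: (@measure_semi_sigma_additive _ _ _ pf). Qed.

HB.instance Definition _ := isMeasure.Build _ _ _ lebesgueS
  lebesgueS0 lebesgueS_ge0 lebesgueS_sigma_additive.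

Let lebesgueS_sigma_finite : sigma_finite setT lebesgueS.
Proof.
have /sigma_finiteP[F [FT ndF Ffin]] :=
  sigma_finiteT (@lebesgue_measure R : {sigma_finite_measure set _ -> \bar R}).
have /sigma_finiteP[G [GT ndG Gfin]] := sigma_finiteT m.
pose uncons (x : Rn R n.+1) : measurableTypeR R * Rn R n :=
  (thead x, [tuple of behead x]).
have muncons : measurable_fun setT uncons.
  by apply: measurable_fun_pair; [exact: measurable_tnth|
    exact: measurable_behead].
exists (fun k => uncons @^-1` (F k `*` G k)).
  apply/esym; rewrite -subTset => x _.
  have [i _ Fi] : (\bigcup_i F i) (thead x) by rewrite -FT.
  have [j _ Gj] : (\bigcup_i G i) [tuple of behead x] by rewrite -GT.
  exists (maxn i j) => //; split => /=.
    by move: Fi; exact/subsetPset/ndF/leq_maxl.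
  by move: Gj; exact/subsetPset/ndG/leq_maxr.
move=> k; have [mFk Fkoo] := Ffin k; have [mGk Gkoo] := Gfin k; split.
  by rewrite -[X in measurable X]setTI; apply: muncons => //; exact: measurableX.
rewrite /lebesgueS /pushforward -comp_preimage.
rewrite (_ : uncons \o @consRn n = id).
  by rewrite preimage_id product_measure1E// lte_mul_pinfty// ge0_fin_numE.
by apply/funext => -[a t]; congr pair; exact: val_inj.
Qed.

HB.instance Definition _ :=
  Measure_isSigmaFinite.Build _ _ _ lebesgueS lebesgueS_sigma_finite.
End lebesgueS.

Fixpoint lebesgue_measureRn n : {sigma_finite_measure set (Rn R n) -> \bar R} :=
  if n is n'.+1 then lebesgueS (lebesgue_measureRn n')
  else @dirac _ (Rn R 0) [tuple] R.

Lemma lebesgue_measureRn_box n (A : 'I_n -> set (measurableTypeR R)) :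
  (forall i, measurable (A i)) ->
  lebesgue_measureRn n [set x | forall i, A i (tnth x i)] =
  (\prod_(i < n) lebesgue_measure (A i))%E.
Proof.
elim: n A => [|n IH] A mA.
  rewrite big_ord0 /= diracE mem_set//= => -[].
  by case.
rewrite big_ord_recl -IH; last by move=> i; exact: mA.
rewrite /= -product_measure1E//; last first.
  rewrite (_ : [set x | _] = \bigcap_(i in [set: 'I_n])
      ((fun x : Rn R n => tnth x i) @^-1` A (lift ord0 i))).
    apply: fin_bigcap_measurable => // i _.
    by rewrite -[X in measurable X]setTI; exact: measurable_tnth.
  by apply/seteqP; split => x /= => [h i _|h i]; exact: h.
rewrite /lebesgueS /pushforward; congr (_ _).
apply/seteqP; split => -[a t] /=.
  move=> h; split; first exact: (h ord0).
  by move=> i; have := h (lift ord0 i); rewrite tnthS.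
move=> [h0 h] i; case: (unliftP ord0 i) => [j|] ->//.
by rewrite tnthS.
Qed.
End LebesgueRn.

Local Open Scope ereal_scope.

Section DyadicBMO.
Context {R : realType} {n : nat}.
Local Notation mu := (lebesgue_measureRn n : set (Rn R n) -> \bar R).
Implicit Types (D S : set (set (Rn R n))) (P Q K : set (Rn R n)).
Implicit Types (f b : Rn R n -> \bar R).

(* No convention is imposed on which faces belong to the cube: the Booleans c
   and d select, for each coordinate, whether the endpoints are included. *)
Definition is_cube (l : R) Q :=
  exists (a : 'I_n -> R) (c d : 'I_n -> bool),
    Q = [set x | forall i,
      (tnth x i : R) \in Interval (BSide (c i) (a i)) (BSide (d i) (a i + l)%R)].

Definition generation D (k : int) : set (set (Rn R n)) :=
  [set Q | D Q /\ is_cube ((2%:R : R) ^ k)%R Q].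

Definition dyadic_grid D :=
  [/\ forall Q, D Q -> exists k, generation D k Q,
      forall k, partition (generation D k) id [set: Rn R n] &
      forall P Q, D P -> D Q -> [\/ P `&` Q = P, P `&` Q = Q | P `&` Q = set0]].

Definition carleson D S (Lambda : R) :=
  forall Q, D Q ->
    \esum_(P in [set P | S P /\ P `<=` Q]) mu P <= Lambda%:E * mu Q.

Definition infinitely_increasing_chain S :=
  exists Q : nat -> set (Rn R n),
    (forall k, S (Q k)) /\ forall k, Q k `<` Q k.+1.

(* \bar R-valued: the series may diverge on a null set *)
Definition sum_indic S : Rn R n -> \bar R :=
  fun x => \esum_(Q in S) (\1_Q x)%:E.

(* compactness is taken in the usual topology of 'rV[R]_n *)
Definition loc_integrable f :=
  measurable_fun [set: Rn R n] f /\
  forall K, compact [set (\row_(i < n) (tnth x i : R))%R | x in K] ->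
    \int[mu]_(x in K) `|f x| < +oo.

Definition average f Q : \bar R := (mu Q)^-1 * \int[mu]_(x in Q) f x.

Definition BMO_norm D b : \bar R :=
  ereal_sup [set average (fun x => `|b x - average b Q|) Q | Q in D].

Definition BMO D b := loc_integrable b /\ BMO_norm D b < +oo.

End DyadicBMO.

(* Main.v *)
Require Import Defs.
From mathcomp Require Import all_boot all_order all_algebra finmap.
From mathcomp Require Import all_classical all_reals all_analysis measurable_realfun.
From mathcomp Require Import ring lra zify.
Import Order.TTheory GRing.Theory Num.Theory.
Import numFieldNormedType.Exports.
Local Open Scope classical_set_scope.
Local Open Scope ring_scope.

(** The constant [Lambda], rather than the trivial [2 * Lambda], comes from an
L^2 estimate.  Fix a cube [Q] of the grid and let [f] be the sum of the
indicators of the members of [S] contained in [Q].  A member of [S] that meets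
[Q] without being contained in it contains [Q]; such members are nested, and
only finitely many of them exist since they would otherwise form an infinitely
increasing chain ([finite_ancestors]).  Hence [b = f + N] on [Q] for a finite
constant [N], and [b] and [f] have the same mean oscillation on [Q]
([sum_indic_split]).

Let [m] be the mean of [f] on [Q].  Expanding the square as a double sum over
pairs of cubes, of which only nested pairs contribute, the Carleson condition
applied to the larger cube of each pair gives
  [int_Q f^2 <= 2 Lambda int_Q f = 2 Lambda m |Q|]
([integral_sum_indicators_sqr_le]).  The variance of [f] on [Q] is thus at most
[2 Lambda m - m^2 <= Lambda^2], and the mean oscillation is at most the standard
deviation.  The last step is carried out pointwise, through
  [2 Lambda |f - m| + 2 m f <= f^2 + m^2 + Lambda^2],
in which all terms are nonnegative and which therefore also makes sense where
[f] is infinite ([oscillation_sum_indicators_le]).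

For local integrability, a compact set is bounded, so it meets only finitely
many of the disjoint cubes of side 1 ([finite_unit_cubes_near]), and the
integral of [b] over each of those is finite by the decomposition [b = f + N].
Both this finiteness and the countability of the grid, which all exchanges of
sum and integral rely on, are obtained by sending a cube of side [l] to a point
of the lattice [(l/2) Z^n] inside it ([generation_lattice]). *)

(** * Unordered sums and integrals *)

Section Esum.
Context {R : realType} {I : choiceType}.
Implicit Types (A : set I).
Local Open Scope ereal_scope.

(** [J k] is the fibre over [k] of an injection of [A] into [nat]; fibres avoid
enumerating [A], which may be finite or empty. *)
Lemma countable_esumE A : countable A ->
  exists J : nat -> set I,
    (forall k, J k = set0 \/ exists2 i, A i & J k = [set i]) /\
    forall a : I -> \bar R, (forall i, 0 <= a i) ->
      \esum_(i in A) a i = \sum_(0 <= k <oo) \esum_(i in J k) a i.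
Proof.
move=> /countable_injP[f finj].
exists (fun k => A `&` f @^-1` [set k]); split => [k|a a0].
  have [->|/set0P[i [Ai fi]]] := eqVneq (A `&` f @^-1` [set k]) set0; first by left.
  right; exists i => //; apply/seteqP; split => [j [Aj fj]|_ ->] //=.
  by apply: finj; rewrite ?inE// fj.
rewrite -nneseries_sum_bigcup//.
  congr esum; apply/seteqP; split => [i Ai|i [k _ []]//].
  by exists (f i).
by move=> k l _ _ [i [[_ <-] [_ <-]]].
Qed.

Lemma ge0_esumZl A (a : I -> \bar R) (c : \bar R) : 0 <= c ->
  (forall i, 0 <= a i) ->
  \esum_(i in A) (c * a i) = c * \esum_(i in A) a i.
Proof.
move=> c0 a0.
have ca0 i : 0 <= c * a i by rewrite mule_ge0.
(* Only an infinite [c] needs a separate treatment: both sides are then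
infinite as soon as one term is nonzero. *)
have [->|cN0] := eqVneq c 0.
  by rewrite mul0e esum1// => i _; rewrite mul0e.
have [[i [Ai aiN0]]|aall0] := pselect (exists i, A i /\ a i != 0); last first.
  rewrite !esum1 ?mule0// => i Ai.
    by apply: contrapT => /eqP aiN0; apply: aall0; exists i.
  rewrite (_ : a i = 0) ?mule0//.
  by apply: contrapT => /eqP aiN0; apply: aall0; exists i.
have ai0 : 0 < a i by rewrite lt0e aiN0 a0.
have le_term (b : I -> \bar R) : (forall j, 0 <= b j) ->
    b i <= \esum_(j in A) b j.
  move=> b0; apply: esum_ge; exists [set i]; last by rewrite fsbig_set1.
  by split => //; move=> _ ->.
have c_gt0 : 0 < c by rewrite lt0e cN0.
case: c c0 cN0 ca0 c_gt0 => [r|_ _ ca0 _|//]; last first.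
  have -> : +oo * (\esum_(j in A) a j) = +oo.
    by rewrite gt0_mulye// (lt_le_trans ai0)// le_term.
  apply/eqP; rewrite -leye_eq.
  by rewrite (le_trans _ (le_term _ ca0))// gt0_mulye.
move=> r0 rN0 ca0; rewrite lte_fin => r_gt0.
rewrite /esum -ereal_sup_pZl//; congr ereal_sup.
rewrite image_comp; apply: eq_imagel => X [finX XA] /=.
by rewrite ge0_mule_fsumr.
Qed.

End Esum.

Lemma exchange_esum {R : realType} {I J : choiceType} (A : set I) (B : set J)
    (a : I -> J -> \bar R) : (forall i j, 0 <= a i j)%E ->
  (\esum_(i in A) \esum_(j in B) a i j = \esum_(j in B) \esum_(i in A) a i j)%E.
Proof.
move=> a0; rewrite !esum_esum//.
rewrite (@reindex_esum _ _ _ (B `*`` (fun=> A)) _ (fun z => (z.2, z.1)))//.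
split => [[j i] [Bj Ai]//|[j i] [j' i'] _ _ [-> ->]//|[i j] [Ai Bj]].
by exists (j, i).
Qed.

Section IntegralEsum.
Context {d} {T : measurableType d} {R : realType} (mu : {measure set T -> \bar R}).
Context {I : choiceType} (A : set I) (cA : countable A).
Variables (D : set T) (mD : measurable D) (g : I -> T -> \bar R).
Hypothesis mg : forall i, A i -> measurable_fun D (g i).
Hypothesis g0 : forall i x, (0 <= g i x)%E.
Local Open Scope ereal_scope.

Lemma measurable_fun_esum : measurable_fun D (fun x => \esum_(i in A) g i x).
Proof.
have [J [J1 JE]] := @countable_esumE R _ _ cA.
rewrite (_ : (fun x => _) =
    fun x => \sum_(0 <= k <oo | k \in predT) \esum_(i in J k) g i x); last first.
  by apply/funext => x; rewrite JE.
apply: ge0_emeasurable_sum => [k x _ _|k _]; first exact: esum_ge0.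
case: (J1 k) => [->|[i Ai ->]].
  rewrite (_ : (fun x => _) = cst 0)//.
  by apply/funext => x; rewrite esum_set0.
rewrite (_ : (fun x => _) = g i); first exact: mg.
by apply/funext => x; rewrite esum_set1.
Qed.

Lemma ge0_integral_esum :
  \int[mu]_(x in D) (\esum_(i in A) g i x) = \esum_(i in A) \int[mu]_(x in D) g i x.
Proof.
have [J [J1 JE]] := @countable_esumE R _ _ cA.
rewrite JE; last by move=> i; apply: integral_ge0.
under eq_integral do rewrite JE//.
rewrite integral_nneseries//; last first.
- by move=> k x _; exact: esum_ge0.
- move=> k; case: (J1 k) => [->|[i Ai ->]].
    rewrite (_ : (fun x => _) = cst 0)//.
    by apply/funext => x; rewrite esum_set0.
  rewrite (_ : (fun x => _) = g i); first exact: mg.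
  by apply/funext => x; rewrite esum_set1.
apply: eq_eseriesr => k _; case: (J1 k) => [->|[i Ai ->]].
  by rewrite esum_set0; under eq_integral do rewrite esum_set0; rewrite integral0.
rewrite esum_set1; last exact: integral_ge0.
by under eq_integral do rewrite esum_set1//.
Qed.

End IntegralEsum.

(** * Mean oscillation of sums of indicators over nested families *)

(** In this section, [Q] stands for a cube and [C] for the members of the sparse
collection contained in it. *)
Section NestedFamily.
Context {d} {T : measurableType d} {R : realType} (mu : {measure set T -> \bar R}).
Variable C : set (set T).
Hypotheses (cC : countable C) (mC : forall P, C P -> measurable P).
Local Open Scope ereal_scope.
Let f (x : T) : \bar R := \esum_(P in C) (\1_P x)%:E.

Lemma sum_indicators_ge0 x : 0 <= f x.
Proof. exact: esum_ge0. Qed.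

Lemma measurable_sum_indicators D : measurable D -> measurable_fun D f.
Proof.
move=> mD; apply: measurable_fun_esum => // P CP.
by apply/measurable_EFinP; apply: measurable_indic; exact: mC.
Qed.

Lemma integral_sum_indicators D : measurable D ->
  \int[mu]_(x in D) f x = \esum_(P in C) mu (P `&` D).
Proof.
move=> mD; rewrite ge0_integral_esum//; last first.
  by move=> P CP; apply/measurable_EFinP; apply: measurable_indic; exact: mC.
by apply: eq_esum => P CP; rewrite integral_indic//; exact: mC.
Qed.

Lemma integral_sum_indicators_sqr D : measurable D ->
  \int[mu]_(x in D) (f x * f x) =
  \esum_(P in C) \esum_(P' in C) mu (P' `&` (P `&` D)).
Proof.
move=> mD.
have mI P : C P -> measurable_fun D (fun x => (\1_P x)%:E : \bar R).
  by move=> CP; apply/measurable_EFinP; apply: measurable_indic; exact: mC.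
have f0 := sum_indicators_ge0.
under eq_integral do rewrite {2}/f -ge0_esumZl//.
rewrite ge0_integral_esum//; last first.
- by move=> P x; rewrite mule_ge0.
- by move=> P CP; apply: emeasurable_funM; [exact: measurable_sum_indicators|exact: mI].
apply: eq_esum => P CP.
rewrite -integral_sum_indicators; last by apply: measurableI => //; exact: mC.
rewrite setIC [RHS]integral_mkcondr; apply: eq_integral => x _.
by rewrite /patch indicE; case: ifPn; rewrite ?mule1 ?mule0.
Qed.

Variables (Lambda : R) (Q : set T).
Hypotheses (Lambda0 : (0 < Lambda)%R) (mQ : measurable Q).
Hypotheses (CQ : forall P, C P -> P `<=` Q).
Hypothesis nested : forall P P', C P -> C P' ->
  [\/ P `&` P' = P, P `&` P' = P' | P `&` P' = set0].
Hypothesis packing : forall P, C P ->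
  \esum_(P' in [set P' | C P' /\ P' `<=` P]) mu P' <= Lambda%:E * mu P.

(** In a double sum over a nested family, each pair of members that meet has a
larger member; grouping the pairs by it, in either order, bounds the sum by
twice the packing sum. *)
Lemma integral_sum_indicators_sqr_le :
  \int[mu]_(x in Q) (f x * f x) <= (2 * Lambda)%:E * \int[mu]_(x in Q) f x.
Proof.
rewrite integral_sum_indicators_sqr// integral_sum_indicators//.
have fQ : \esum_(P in C) mu (P `&` Q) = \esum_(P in C) mu P.
  by apply: eq_esum => P CP; rewrite setIidl//; exact: CQ.
rewrite fQ.
pose sub (P P' : set T) := if `[< P' `<=` P >] then mu P' else 0.
have sub0 P P' : 0 <= sub P P' by rewrite /sub; case: ifPn.
have pairs P P' : C P -> C P' -> mu (P' `&` (P `&` Q)) <= sub P P' + sub P' P.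
  move=> CP CP'; rewrite (setIidl (CQ _ CP)) /sub.
  case: (nested _ _ CP' CP) => PP'; rewrite PP'.
  - by rewrite ifT ?leeDl//; [case: ifPn|apply/asboolP/setIidPl].
  - by rewrite [X in _ + X]ifT ?leeDr//; [case: ifPn|apply/asboolP/setIidPr].
  - by rewrite measure0 adde_ge0//; exact: sub0.
have half : \esum_(P in C) \esum_(P' in C) sub P P' <=
    Lambda%:E * \esum_(P in C) mu P.
  rewrite -ge0_esumZl//; last by rewrite lee_fin ltW.
  apply: le_esum => P CP; apply: le_trans (packing _ CP).
  rewrite (esum_mkcondr C [set P' | P' `<=` P]); apply: le_esum => P' _.
  by rewrite /sub; case: ifPn => [/asboolP|]//; case: ifPn => //; rewrite ?inE.
have -> : (2 * Lambda)%:E * (\esum_(P in C) mu P) =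
    Lambda%:E * (\esum_(P in C) mu P) + Lambda%:E * \esum_(P in C) mu P.
  rewrite mulr_natl mulr2n EFinD ge0_muleDl// lee_fin ltW//.
apply: le_trans (leeD half half).
rewrite [X in _ <= _ + X]exchange_esum//.
rewrite -esumD//; [|by move=> P _; exact: esum_ge0..].
apply: le_esum => P CP; rewrite -esumD//.
by apply: le_esum => P' CP'; exact: pairs.
Qed.

Variable (q : R).
Hypotheses (q0 : (0 < q)%R) (muQ : mu Q = q%:E).
Hypothesis packingQ : \esum_(P in C) mu P <= Lambda%:E * mu Q.

Lemma mean_sum_indicators : exists2 m : R, (0 <= m)%R &
  \int[mu]_(x in Q) f x = (m * q)%:E.
Proof.
have : 0 <= \int[mu]_(x in Q) f x.
  by apply: integral_ge0 => x _; exact: sum_indicators_ge0.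
have : \int[mu]_(x in Q) f x <= (Lambda * q)%:E.
  rewrite integral_sum_indicators// EFinM -muQ; apply: le_trans packingQ.
  by apply: le_esum => P CP; rewrite setIidl//; exact: CQ.
case: (\int[mu]_(x in Q) f x) => [r||]//; rewrite !lee_fin => rL r0.
exists (r / q)%R; first by rewrite divr_ge0// ltW.
by rewrite divfK// gt_eqF.
Qed.

(** The weights in [2 Lambda |f - m| <= (f - m)^2 + Lambda^2] are those for which
the integrated bound [Lambda^2 + 2 Lambda m - m^2], with [m] the mean of [f], is
[2 Lambda^2 - (Lambda - m)^2]. *)
Lemma oscillation_sum_indicators_le (m : R) : (0 <= m)%R ->
  \int[mu]_(x in Q) f x = (m * q)%:E ->
  \int[mu]_(x in Q) `|f x - m%:E| <= (Lambda * q)%:E.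
Proof.
move=> m0 fE.
have mf := measurable_sum_indicators _ mQ.
have f0 := sum_indicators_ge0.
have mosc : measurable_fun Q (fun x => `|f x - m%:E|).
  by apply: measurableT_comp => //; apply: emeasurable_funB.
have L0 : (0 <= 2 * Lambda)%R by rewrite mulr_ge0// ltW.
have m20 : (0 <= 2 * m)%R by rewrite mulr_ge0.
have c0 : (0 <= m ^+ 2 + Lambda ^+ 2)%R by rewrite addr_ge0// sqr_ge0.
(* This is [0 <= (|f x - m| - Lambda)^2], with the terms rearranged so that
no subtraction of infinite values occurs. *)
have pointwise x : (2 * Lambda)%:E * `|f x - m%:E| + (2 * m)%:E * f x <=
    f x * f x + (m ^+ 2 + Lambda ^+ 2)%:E.
  have := f0 x; case: (f x) => [y| |]// y0; last by rewrite mulyy addye ?leey.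
  rewrite -EFinB abse_EFin -!EFinM -!EFinD lee_fin.
  have := sqr_ge0 (y - m - Lambda); have := sqr_ge0 (y - m + Lambda).
  by case: (ger0P (y - m)) => _; nra.
have : \int[mu]_(x in Q) ((2 * Lambda)%:E * `|f x - m%:E| + (2 * m)%:E * f x) <=
    \int[mu]_(x in Q) (f x * f x + (m ^+ 2 + Lambda ^+ 2)%:E).
  apply: ge0_le_integral => //.
  - by move=> x _; rewrite adde_ge0// mule_ge0.
  - by apply: emeasurable_funD; apply: emeasurable_funM.
  - by apply: emeasurable_funD => //; apply: emeasurable_funM.
rewrite !ge0_integralD//; first last.
- by apply: emeasurable_funM.
- by move=> x _; rewrite mule_ge0.
- by apply: emeasurable_funM.
- by move=> x _; rewrite mule_ge0.
- by apply: emeasurable_funM.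
- by move=> x _; rewrite mule_ge0.
rewrite !ge0_integralZl_EFin// fE (integral_cst mu mQ (m ^+ 2 + Lambda ^+ 2)%:E) muQ.
move=> /le_trans /(_ (leeD integral_sum_indicators_sqr_le (lexx _))).
rewrite fE.
have : 0 <= \int[mu]_(x in Q) `|f x - m%:E| by apply: integral_ge0.
(* An infinite oscillation would contradict the finite bound on the right. *)
case: (\int[mu]_(x in Q) _) => [X X0| _|]//; last first.
  by rewrite gt0_muley ?lte_fin ?mulr_gt0.
rewrite -!EFinM -!EFinD !lee_fin => H.
have : (2 * Lambda * X <= 2 * Lambda * (Lambda * q))%R.
  have : (0 <= (Lambda - m) ^+ 2 * q)%R by rewrite mulr_ge0 ?sqr_ge0// ltW.
  by nra.
by rewrite ler_pM2l// mulr_gt0.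
Qed.

End NestedFamily.

(** * Cubes and dyadic grids *)

Lemma finite_set_injective {T U : Type} {A : set T} {B : set U} (f : T -> U) :
  {in A &, injective f} -> (forall x, A x -> B (f x)) -> finite_set B ->
  finite_set A.
Proof.
move=> finj fAB finB; rewrite -(eq_finite_set (inj_card_eq finj)).
by apply: sub_finite_set finB => _ [x Ax <-]; exact: fAB.
Qed.

Section Cubes.
Context {R : realType} {n : nat}.
Implicit Types (l : R) (Q : set (Rn R n)).
Local Notation mu := (lebesgue_measureRn n : set (Rn R n) -> \bar R).

Definition itv_cube (a : 'I_n -> R) l (c d : 'I_n -> bool) (i : 'I_n) : interval R :=
  Interval (BSide (c i) (a i)) (BSide (d i) (a i + l)).

Lemma measurable_cube l Q : is_cube l Q -> measurable Q.
Proof.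
move=> [a [c [d ->]]].
rewrite (_ : [set x | _] = \bigcap_(i in [set: 'I_n])
    ((fun x : Rn R n => tnth x i) @^-1` [set` itv_cube a l c d i])).
  apply: fin_bigcap_measurable => // i _.
  by rewrite -[X in measurable X]setTI;
    apply: measurable_tnth => //; exact: measurable_itv.
by apply/seteqP; split => x /= => [h i _|h i]; exact: h.
Qed.

Lemma measure_cube l Q : 0 < l -> is_cube l Q -> mu Q = (l ^+ n)%:E.
Proof.
move=> l0 [a [c [d ->]]].
have -> := @lebesgue_measureRn_box R n (fun i => [set` itv_cube a l c d i])
  (fun i => measurable_itv _).
rewrite (eq_bigr (fun=> l%:E)) => [|i _].
  by rewrite prodEFin prodr_const card_ord.
by rewrite lebesgue_measure_itv /= lte_fin ltrDl l0 -EFinB addrC addKr.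
Qed.

Definition lattice_point l (z : n.-tuple int) : Rn R n :=
  [tuple (tnth z i)%:~R * (l / 2) | i < n].

(** An open interval of length [l] contains a multiple of [l / 2]; being interior,
that point belongs to the cube whatever faces the cube includes. *)
Lemma cube_lattice_point l Q : 0 < l -> is_cube l Q ->
  exists z, Q (lattice_point l z).
Proof.
move=> l0 [a [c [d ->]]].
exists [tuple Num.floor (a i / (l / 2)) + 1 | i < n] => i; rewrite !tnth_mktuple.
have l20 : 0 < l / 2 by rewrite divr_gt0.
have /andP[fl fg] := floor_itv (a i / (l / 2)).
rewrite ler_pdivlMr// in fl; rewrite ltr_pdivrMr// in fg.
have az : a i < (Num.floor (a i / (l / 2)) + 1)%:~R * (l / 2) by [].
have zb : (Num.floor (a i / (l / 2)) + 1)%:~R * (l / 2) < a i + l.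
  by rewrite intrD mulrDl mul1r; lra.
by case: (c i); case: (d i); rewrite in_itv/= ?az ?zb ?(ltW az) ?(ltW zb).
Qed.

Lemma cube_dist_le l Q (x y : Rn R n) i : is_cube l Q -> Q x -> Q y ->
  `|tnth x i - tnth y i| <= l.
Proof.
move=> [a [c [d ->]]] /(_ i) xQ /(_ i) yQ.
have sub z : z \in itv_cube a l c d i -> a i <= z <= a i + l.
  by rewrite /itv_cube; case: (c i); case: (d i); rewrite in_itv/= => /andP[az zb];
    apply/andP; split => //; exact: ltW.
have /andP[x1 x2] := sub _ xQ; have /andP[y1 y2] := sub _ yQ.
by rewrite ler_norml; lra.
Qed.

End Cubes.

Section Grid.
Context {R : realType} {n : nat} (D : set (set (Rn R n))) (hD : dyadic_grid D).
Implicit Types (P Q : set (Rn R n)) (k : int).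
Local Notation mu := (lebesgue_measureRn n : set (Rn R n) -> \bar R).

Let side_gt0 k : (0 : R) < 2%:R ^ k.
Proof. by rewrite exprz_gt0. Qed.

Lemma grid_measurable P : D P -> measurable P.
Proof. by have [hgen _ _] := hD; move=> /hgen[k [_ /measurable_cube]]. Qed.

Lemma grid_measure P : D P -> exists2 q : R, 0 < q & mu P = q%:E.
Proof.
have [hgen _ _] := hD; move=> /hgen[k [_ cP]].
exists ((2%:R ^ k) ^+ n); first by rewrite exprn_gt0.
by rewrite (measure_cube _ _ _ cP).
Qed.

Lemma grid_nonempty P : D P -> P !=set0.
Proof.
have [hgen _ _] := hD; move=> /hgen[k [_ cP]].
by have [z Pz] := cube_lattice_point _ _ (side_gt0 k) cP;
  exists (lattice_point (2%:R ^ k) z).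
Qed.

Lemma generation_eq k P Q : generation D k P -> generation D k Q ->
  P `&` Q !=set0 -> P = Q.
Proof. by have [_ /(_ k)[_ triv _] _] := hD; exact: triv. Qed.

(** The side length is read off the measure, which determines it only in
positive dimension. *)
Lemma generation_le k k' P Q : (0 < n)%N -> generation D k P ->
  generation D k' Q -> P `<=` Q -> (k <= k')%R.
Proof.
move=> n0 [DP cP] [DQ cQ] PQ.
have : (mu P <= mu Q)%E by apply: le_measure => //; rewrite inE; exact: grid_measurable.
rewrite (measure_cube _ _ _ cP)// (measure_cube _ _ _ cQ)// lee_fin.
by rewrite ler_pXn2r// ?nnegrE ?(ltW (side_gt0 _))// ler_eXz2l// ltr1n.
Qed.

(** Distinct cubes of a generation are disjoint, so choosing a lattice point in
each of them labels them injectively by tuples of integers. *)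
Lemma generation_lattice k : exists z : set (Rn R n) -> n.-tuple int,
  (forall P, generation D k P -> P (lattice_point (2%:R ^ k) (z P))) /\
  {in generation D k &, injective z}.
Proof.
have /choice[z zP] : forall P, exists z : n.-tuple int,
    generation D k P -> P (lattice_point (2%:R ^ k) z).
  move=> P; have [[DP cP]|nP] := pselect (generation D k P); last first.
    by exists [tuple 0 | i < n].
  by have [z Pz] := cube_lattice_point _ _ (side_gt0 k) cP; exists z.
exists z; split => // P Q; rewrite !inE => gP gQ zPQ.
apply: (generation_eq _ _ _ gP gQ).
by exists (lattice_point (2%:R ^ k) (z P)); split; [|rewrite zPQ]; exact: zP.
Qed.

Lemma grid_countable : countable D.
Proof.
have [hgen _ _] := hD.
apply: (@sub_countable _ _ _ (\bigcup_(k in [set: int]) generation D k)).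
  by apply: subset_card_le => P /hgen[k gP]; exists k.
apply: bigcup_countable => // k _.
have [z [_ zinj]] := generation_lattice k.
apply/countable_injP; exists (choice.pickle \o z) => P Q gP gQ.
move=> /(pcan_inj (@choice.pickleK _)).
exact: zinj.
Qed.

Lemma finite_unit_cubes_near (M : R) :
  finite_set [set P | generation D 0 P /\
    exists2 x, P x & forall i, `|tnth x i| <= M].
Proof.
have [z [zP zinj]] := generation_lattice 0.
(* A label [z] satisfies [|z / 2| <= M + 1] in each coordinate. *)
pose N := Num.truncn (2 * M + 2).
have zN P i : (generation D 0 P /\ exists2 x, P x & forall i, `|tnth x i| <= M) ->
    (`|tnth (z P) i| <= N)%N.
  move=> [gP [x Px xM]].
  have := cube_dist_le _ _ _ _ i gP.2 (zP _ gP) Px.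
  rewrite tnth_mktuple expr0z => dist.
  have := xM i; rewrite !ler_norml in dist * => xMi.
  rewrite /N truncn_ge_nat; last by lra.
  by rewrite natr_absz intr_norm ler_norml; lra.
pose g P : {ffun 'I_n -> 'I_(N.*2.+1)} :=
  [ffun i => inord `|tnth (z P) i + N%:Z|].
apply: (@finite_set_injective _ _ _ setT g) => //.
move=> P Q; rewrite !inE => hP hQ gPQ.
apply: zinj; rewrite ?inE; [exact: hP.1|exact: hQ.1|].
apply: eq_from_tnth => i; have /ffunP/(_ i) := gPQ.
rewrite !ffunE => /(congr1 val) /=.
have := zN _ i hP; have := zN _ i hQ => zQN zPN.
by rewrite !inordK; lia.
Qed.

(** The members of [S] containing [Q] form a chain.  If that chain had a largest member,
its generations would be bounded on both sides, so it would be finite, each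
generation containing at most one cube that meets [Q].  Hence an infinite chain
has no largest member, and always moving to a strictly larger cube produces an
infinitely increasing chain. *)
Lemma finite_ancestors (S : set (set (Rn R n))) Q : (0 < n)%N -> S `<=` D ->
  ~ infinitely_increasing_chain S -> D Q ->
  finite_set [set P | S P /\ Q `<=` P].
Proof.
move=> n0 SD nochain DQ; apply: contrapT => Xinf.
set X := [set P | _] in Xinf.
have [hgen _ nested] := hD.
have /choice[gen genP] : forall P, exists k, D P -> generation D k P.
  move=> P; have [DP|nP] := pselect (D P); last by exists 0.
  by have [k gk] := hgen P DP; exists k.
have [x Qx] := grid_nonempty _ DQ.
have DX P : X P -> D P by move=> [/SD].
have succ P : exists P', X P -> X P' /\ P `<` P'.
  have [XP|nXP] := pselect (X P); last by exists P.
  apply: contrapT => nsucc; apply: Xinf.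
  have Psup P' : X P' -> P' `<=` P.
    move=> XP'; case: (nested P P' (DX _ XP) (DX _ XP')).
    - move=> /setIidPl PP'; have [//|nP'P] := pselect (P' `<=` P).
      by exfalso; apply: nsucc; exists P' => _; split => //; split.
    - by move=> /setIidPr.
    - move=> PP'; exfalso.
      have : (P `&` P') x by split; [exact: XP.2|exact: XP'.2].
      by rewrite PP'.
  have bounds P' : X P' -> (gen Q <= gen P' <= gen P)%R.
    move=> XP'; apply/andP; split.
      by apply: (generation_le _ _ Q P' n0);
        [exact: genP|apply: genP; exact: DX|exact: XP'.2].
    by apply: (generation_le _ _ P' P n0);
      [apply: genP; exact: DX|apply: genP; exact: DX|exact: Psup].
  apply: (@finite_set_injective _ _ _ `I_(`|gen P - gen Q|.+1)
    (fun P' => `|gen P' - gen Q|%N)) => //.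
    move=> P1 P2; rewrite !inE => X1 X2 e12.
    have := bounds _ X1; have := bounds _ X2 => b2 b1.
    have {}e12 : gen P1 = gen P2 by lia.
    apply: (generation_eq (gen P1)); first exact: genP (DX _ X1).
      by rewrite e12; exact: genP (DX _ X2).
    by exists x; split; [exact: X1.2|exact: X2.2].
  by move=> P' /bounds; rewrite /=; lia.
have [next nextP] := choice succ.
have [P0 XP0] : X !=set0.
  by apply/set0P; apply: contra_notN Xinf => /eqP ->; exact: finite_set0.
have XP (j : nat) : X (iter j next P0) by elim: j => //= j /nextP[].
apply: nochain; exists (fun j => iter j next P0); split => j; first exact: (XP j).1.
by have [] := nextP _ (XP j).
Qed.

End Grid.

(** * Integrals over compact sets *)

(** The integral of a nonnegative function is a supremum over simple functions
below it, which makes it monotone in the domain whatever the sets are.  This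
serves for a compact set, compared with a union of finitely many cubes. *)
Lemma ge0_subset_integral_nonmeasurable {d} {T : measurableType d} {R : realType}
    (mu : {measure set T -> \bar R}) (A B : set T) (f : T -> \bar R) :
  A `<=` B -> (forall x, 0 <= f x)%E ->
  (\int[mu]_(x in A) f x <= \int[mu]_(x in B) f x)%E.
Proof.
move=> AB f0.
rewrite !ge0_integralE//; apply: ereal_sup_le.
move=> _ [h hf <-]; exists h => // x; apply: le_trans (hf x) _.
rewrite !patchE; case: ifPn => [xA|_]; last by case: ifPn.
by rewrite ifT// mem_set//; apply: AB; rewrite inE in xA.
Qed.

Lemma compact_coordinates_bounded (R : realType) (n : nat) (K : set (Rn R n)) :
  compact [set (\row_(i < n) (tnth x i : R))%R | x in K] ->
  exists M : R, forall x, K x -> forall i, (`|tnth x i| <= M)%R.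
Proof.
move=> /compact_bounded /pinfty_ex_gt0[M M0 KM]; exists M => x Kx i.
have /KM : [set (\row_(i < n) (tnth x i : R))%R | x in K] (\row_(i < n) (tnth x i : R))%R.
  by exists x.
apply: le_trans.
have := mx_normrE (\row_(i < n) (tnth x i : R))%R.
rewrite /Num.norm/= => ->.
by apply: (le_trans _ (le_bigmax _ _ (ord0, i))) => /=; rewrite mxE.
Qed.

(** * Sums of indicators of sparse collections *)

Section SparseSum.
Context {R : realType} {n : nat} (n0 : (0 < n)%N).
Context (D : set (set (Rn R n))) (hD : dyadic_grid D).
Context (Lambda : R) (Lambda0 : 0 < Lambda).
Context (S : set (set (Rn R n))) (SD : S `<=` D) (hcarleson : carleson D S Lambda).
Hypothesis nochain : ~ infinitely_increasing_chain S.
Implicit Types (P Q : set (Rn R n)).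
Local Notation mu := (lebesgue_measureRn n).
Local Open Scope ereal_scope.
Let inside Q : set (set (Rn R n)) := [set P | S P /\ P `<=` Q].

Lemma countable_sub_grid C : C `<=` S -> countable C.
Proof.
move=> CS; apply: sub_countable (grid_countable _ hD).
by apply: subset_card_le => P /CS/SD.
Qed.

(** [N] counts the members of [S] strictly containing [Q]. *)
Lemma sum_indic_split Q : D Q -> exists2 N : R, (0 <= N)%R &
  forall x, Q x -> sum_indic S x = sum_indic (inside Q) x + N%:E.
Proof.
move=> DQ; have [_ _ nested] := hD.
pose outer := [set P | S P /\ Q `<=` P] `\` [set P | P `<=` Q].
have outer_fin : finite_set outer.
  apply: sub_finite_set (finite_ancestors _ hD _ _ n0 SD nochain DQ).
  by move=> P [].
exists (\sum_(P \in outer) (1 : R))%R.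
  by rewrite fsbig_finite//= sumr_ge0.
move=> x Qx; rewrite /sum_indic (esumID [set P | P `<=` Q])//.
congr (_ + _).
rewrite -fsumEFin// -esum_fset//.
rewrite (esum_mkcond outer) (esum_mkcond (S `&` _)).
apply: eq_esum => P _; case: ifPn.
  rewrite inE => -[SP nPQ]; rewrite indicE.
  case: (nested P Q (SD _ SP) DQ).
  - by move=> /setIidPl.
  - move=> /setIidPr QP; rewrite mem_set; last exact: QP.
    by rewrite ifT// mem_set//; split.
  - move=> PQ0; rewrite memNset; last first.
      by move=> Px; have : (P `&` Q) x by []; rewrite PQ0.
    rewrite ifF//; apply/negbTE; rewrite notin_setE => -[[_ QP] _].
    by have : (P `&` Q) x by [split => //; exact: QP]; rewrite PQ0.
rewrite notin_setE => h; rewrite ifF//; apply/negbTE; rewrite notin_setE => -[[SP _] nPQ].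
by apply: h; split.
Qed.

Lemma mean_oscillation_cube Q : D Q ->
  \int[mu]_(x in Q) sum_indic S x < +oo /\
  average (fun x => `|sum_indic S x - average (sum_indic S) Q|) Q <= Lambda%:E.
Proof.
move=> DQ; have [_ _ nested] := hD.
have mQ := grid_measurable _ hD _ DQ.
have [q q0 muQ] := grid_measure _ hD _ DQ.
have [N N0 bE] := sum_indic_split _ DQ.
have inS : inside Q `<=` S by move=> P [].
have cI := countable_sub_grid _ inS.
have mI P : inside Q P -> measurable P by move=> /inS/SD; exact: grid_measurable.
have IQ P : inside Q P -> P `<=` Q by case.
have nestedI P P' : inside Q P -> inside Q P' ->
    [\/ P `&` P' = P, P `&` P' = P' | P `&` P' = set0].
  by move=> /inS/SD DP /inS/SD DP'; exact: nested.
have packingI P : inside Q P ->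
    \esum_(P' in [set P' | inside Q P' /\ P' `<=` P]) mu P' <= Lambda%:E * mu P.
  move=> [SP PQ]; rewrite [X in \esum_(_ in X) _](_ : _ = inside P).
    exact: (hcarleson _ (SD _ SP)).
  by apply/seteqP; split => [P' [[SP' _] P'P]|P' [SP' P'P]] //; split => //; split => //;
    exact: subset_trans PQ.
have [m m0 fE] := mean_sum_indicators mu _ cI mI _ _ mQ IQ _ q0 muQ
  (hcarleson _ DQ).
have osc := oscillation_sum_indicators_le mu _ cI mI _ _ Lambda0 mQ IQ nestedI packingI
  _ q0 muQ _ m0 fE.
have intb : \int[mu]_(x in Q) sum_indic S x = ((m + N) * q)%:E.
  rewrite (eq_integral (fun x => sum_indic (inside Q) x + (cst N%:E) x)); last first.
    by move=> x; rewrite inE => /bE.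
  rewrite ge0_integralD//.
  - by rewrite integral_cst// [X in N%:E * X](muQ : _ = _) fE -EFinM -EFinD mulrDl.
  - by move=> x _; exact: sum_indicators_ge0.
  - exact: measurable_sum_indicators.
split; first by rewrite intb ltry.
have avgb : average (sum_indic S) Q = (m + N)%:E.
  by rewrite /average intb muQ inver gt_eqF// -EFinM mulrC mulfK// gt_eqF.
rewrite avgb /average muQ inver gt_eqF//.
rewrite (eq_integral (fun x => `|sum_indic (inside Q) x - m%:E|)); last first.
  move=> x; rewrite inE => Qx; rewrite bE//; congr abse.
  have : 0 <= sum_indic (inside Q) x by exact: sum_indicators_ge0.
  case: (sum_indic _ x) => [r| |]// _.
  by rewrite -EFinD -!EFinB; congr EFin; ring.
apply: (@le_trans _ _ ((q^-1)%:E * (Lambda * q)%:E)).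
  by apply: lee_wpmul2l => //; rewrite lee_fin invr_ge0 ltW.
by rewrite -EFinM mulrC mulfK// gt_eqF.
Qed.

Lemma sum_indic_loc_integrable : loc_integrable (sum_indic S).
Proof.
have b0 : forall x, 0 <= sum_indic S x by move=> x; exact: sum_indicators_ge0.
have mb E : measurable E -> measurable_fun E (sum_indic S).
  apply: measurable_sum_indicators; first exact: countable_sub_grid.
  by move=> P /SD; exact: grid_measurable.
split; first exact: mb.
move=> K /compact_coordinates_bounded[M KM].
have := finite_unit_cubes_near _ hD M; set F := [set P | _] => finF.
(* Outside [F] the family is set to the empty set, so that all its members are
measurable. *)
have KF : K `<=` \big[setU/set0]_(P <- fset_set F) (if P \in F then P else set0).
  move=> x Kx; have [_ /(_ 0%R)[cov _ _] _] := hD.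
  have [P gP Px] : cover (generation D 0) id x by rewrite cov.
  have FP : F P by split => //; exists x => //; exact: KM.
  rewrite -bigcup_seq; exists P; first by rewrite /= in_fset_set// mem_set.
  by rewrite mem_set.
have mF P : measurable (if P \in F then P else set0).
  case: ifPn => // /[!inE] -[[DP _] _]; exact: grid_measurable DP.
under eq_integral do rewrite gee0_abs//.
apply: le_lt_trans (ge0_subset_integral_nonmeasurable mu _ _ _ KF b0) _.
rewrite ge0_integral_bigsetU//.
- apply: lte_sum_pinfty => P _; case: ifPn => [/[!inE] -[[DP _] _]|_].
    by have [] := mean_oscillation_cube _ DP.
  by rewrite integral_set0.
- move=> P Q; rewrite /= !in_fset_set// !inE => FP FQ.
  by rewrite !mem_set//; exact: generation_eq FP.1 FQ.1.
- by apply: mb; apply: bigsetU_measurable.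
Qed.

End SparseSum.

Theorem theorem2p3 (R : realType) (n : nat) (hn : (0 < n)%N)
    (D : set (set (Rn R n))) (hD : dyadic_grid D)
    (Lambda : R) (hLambda : 1 < Lambda)
    (S : set (set (Rn R n))) (hSD : S `<=` D)
    (hcarleson : carleson D S Lambda)
    (hchain : ~ infinitely_increasing_chain S) :
  BMO D (sum_indic S) /\ (BMO_norm D (sum_indic S) <= Lambda%:E)%E.
Proof.
have Lambda0 : 0 < Lambda by exact: lt_trans hLambda.
have norm_le : (BMO_norm D (sum_indic S) <= Lambda%:E)%E.
  apply: ge_ereal_sup => _ [Q DQ <-].
  exact: (mean_oscillation_cube hn _ hD _ Lambda0 _ hSD hcarleson hchain _ DQ).2.
split=> //; split; last exact: le_lt_trans norm_le (ltry _).
exact: (sum_indic_loc_integrable hn _ hD _ Lambda0 _ hSD hcarleson hchain).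
Qed.
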